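(* For $i=2,3$, the monoid homomorphism $\pi_i:M(\mathcal{P}_i)\to M_i$ is an isomorphism. In particular, $\mathcal{P}_i$ is a presentation for the monoid $M_i$, for $i=2,3$.
   Context: A monoid presentation $\mathcal{P}=\langle\Sigma\mid\mathcal{R}\rangle$ consists of a set $\Sigma$ and a set $\mathcal{R}$ of ordered pairs of words in the free monoid $\Sigma^*$, a pair $(r_1,r_2)$ being written $r_1\to r_2$. $M(\mathcal{P})$ is the monoid $\Sigma^*/\sim$, where $\sim$ is the smallest equivalence relation with $\alpha r_1\beta\sim\alpha r_2\beta$ for all $\alpha,\beta\in\Sigma^*$, $(r_1,r_2)\in\mathcal{R}$. The empty word is denoted $1$. $\mathcal{P}_2=\langle A,B,C_2,c_2\mid\mathcal{R}_2\rangle$, where $\mathcal{R}_2$ consists of the relations (writing $C=C_2$, $c=c_2$): $CAA\to AC$, $CB\to BBC$, $CAB\to BAc$, $cA\to AAc$, $cBB\to Bc$, $cBA\to ABC$, $Cc\to1$, $cC\to1$. $\mathcal{P}_3=\langle A,B,C_3,c_3\mid\mathcal{R}_3\rangle$, where $\mathcal{R}_3$ consists of the relations (writing $C=C_3$, $c=c_3$): $CAAA\to AC$, $CAAB\to BAAc$, $CABA\to BABC$, $CABB\to BBAc$, $CB\to BBBC$, $cA\to AAAc$, $cBAA\to AABC$, $cBAB\to ABAc$, $cBBA\to ABBC$, $cBBB\to Bc$, $Cc\to1$, $cC\to1$. Here $A,B,C_i,c_i$ are formal symbols. Let $T_A:[0,1)\to[0,1/2)$, $T_A(x)=\frac{x}{x+1}$;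 $T_B:[0,1)\to[1/2,1)$, $T_B(x)=\frac1{2-x}$; $T_{C_i}:[0,1)\to[0,1)$, $T_{C_i}(x)=\frac{ix}{(i-1)x+1}$ for $i=2,3$. $M_i$ is the monoid of functions generated, under composition, by $T_A$, $T_B$, $T_{C_i}$ and $T_{C_i}^{-1}$. The homomorphism $\pi_i$ is determined by $A\mapsto T_A$, $B\mapsto T_B$, $C_i\mapsto T_{C_i}$, $c_i\mapsto T_{C_i}^{-1}$ (a word is sent to the corresponding composition, the rightmost letter being applied first); it is well defined because the relations hold among these functions. *)

(* Defs.v *)
From HB Require Import structures.
From mathcomp Require Import all_boot all_order all_algebra.
From mathcomp Require Import generic_quotient.
From mathcomp Require Import boolp classical_sets reals.
From mathcomp Require Import ring lra.
Set Implicit Arguments.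
Unset Strict Implicit.
Unset Printing Implicit Defensive.
Import Order.TTheory GRing.Theory Num.Theory.

Local Open Scope classical_set_scope.
Local Open Scope quotient_scope.

(* A word is a sequence, [::] is the empty word 1, and the pair (r1, r2) in
   [rules] is the relation r1 -> r2. *)
Record presentation := Presentation {
  symbols : choiceType;
  rules : set (seq symbols * seq symbols) }.

Inductive cong (P : presentation) : seq (symbols P) -> seq (symbols P) -> Prop :=
| cong_rule a b r1 r2 :
    rules (r1, r2) -> cong (a ++ r1 ++ b) (a ++ r2 ++ b)
| cong_refl u : cong u u
| cong_sym u v : cong u v -> cong v u
| cong_trans u v w : cong u v -> cong v w -> cong u w.

Section PresentedMonoid.
Variable P : presentation.
Implicit Types u v w : seq (symbols P).

Lemma cong_catl w u v : cong u v -> cong (w ++ u) (w ++ v).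
Proof.
elim=> [a b r1 r2 r|u'|u' v' _|u' v' w' _ + _].
- by rewrite !(catA w); exact: cong_rule.
- exact: cong_refl.
- exact: cong_sym.
- exact: cong_trans.
Qed.

Lemma cong_catr w u v : cong u v -> cong (u ++ w) (v ++ w).
Proof.
elim=> [a b r1 r2 r|u'|u' v' _|u' v' w' _ + _].
- by rewrite -!catA; exact: cong_rule.
- exact: cong_refl.
- exact: cong_sym.
- exact: cong_trans.
Qed.

Definition congb : rel (seq (symbols P)) := fun u v => `[< cong u v >].

Fact congb_refl : reflexive congb.
Proof. by move=> u; apply/asboolP; exact: cong_refl. Qed.

Fact congb_sym : symmetric congb.
Proof.
by move=> u v; apply/idP/idP => /asboolP h; apply/asboolP; exact: cong_sym.
Qed.

Fact congb_trans : transitive congb.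
Proof.
move=> v u w /asboolP uv /asboolP vw; apply/asboolP.
exact: cong_trans uv vw.
Qed.

Canonical congb_equiv := EquivRel congb congb_refl congb_sym congb_trans.

Definition presented := {eq_quot congb}.
HB.instance Definition _ := Choice.on presented.
HB.instance Definition _ := EqQuotient.on presented.

Definition pclass (w : seq (symbols P)) : presented := \pi_presented w.

Lemma pclassP u v : pclass u = pclass v <-> cong u v.
Proof.
split; first by move/(eqquotP presented) => /asboolP.
by move=> uv; apply/(eqquotP presented)/asboolP.
Qed.

Lemma cong_repr w : cong (repr (pclass w)) w.
Proof. by apply/pclassP; rewrite /pclass reprK. Qed.

Lemma presentedW (Q : presented -> Prop) :
  (forall w, Q (pclass w)) -> forall x, Q x.
Proof. by move=> h x; rewrite -[x]reprK; exact: h. Qed.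

Definition presented_one : presented := pclass [::].
Definition presented_mul (x y : presented) : presented :=
  pclass (repr x ++ repr y).

Lemma presented_mulE u v :
  presented_mul (pclass u) (pclass v) = pclass (u ++ v).
Proof.
apply/pclassP; apply: (cong_trans (v := u ++ repr (pclass v))).
  exact/cong_catr/cong_repr.
exact/cong_catl/cong_repr.
Qed.

Fact presented_mulA : associative presented_mul.
Proof.
by elim/presentedW=> u; elim/presentedW=> v; elim/presentedW=> w; rewrite !presented_mulE catA.
Qed.

Fact presented_mul1 : left_id presented_one presented_mul.
Proof. by elim/presentedW=> u; rewrite presented_mulE. Qed.

Fact presented_1mul : right_id presented_one presented_mul.
Proof. by elim/presentedW=> u; rewrite presented_mulE cats0. Qed.

HB.instance Definition _ := isMonoid.Build presented
  presented_mulA presented_mul1 presented_1mul.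

End PresentedMonoid.

Local Open Scope group_scope.

Section Lift.
Variables (P : presentation) (N : monoidType) (f : symbols P -> N).

Definition word_value (w : seq (symbols P)) : N := \prod_(a <- w) f a.

Definition respects_rules :=
  forall r1 r2, rules (r1, r2) -> word_value r1 = word_value r2.

Hypothesis fP : respects_rules.

Lemma word_value_cong u v : cong u v -> word_value u = word_value v.
Proof.
elim=> // [a b r1 r2 r|u' v' w' _ + _]; last by move=> ->.
by rewrite /word_value !big_cat /= -/(word_value r1) -/(word_value r2) (fP r).
Qed.

Definition presented_hom of respects_rules : presented P -> N :=
  fun x => word_value (repr x).

Lemma presented_homE w : presented_hom fP (pclass w) = word_value w.
Proof. exact/word_value_cong/cong_repr. Qed.

End Lift.

Fact presented_hom_is_morphism (P : presentation) (N : monoidType)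
  (f : symbols P -> N) (fP : respects_rules f) :
  monoid.monoid_morphism (presented_hom fP).
Proof.
split; first by rewrite (presented_homE fP [::]) /word_value big_nil.
elim/presentedW=> u; elim/presentedW=> v.
have -> : pclass u * pclass v = pclass (u ++ v) by exact: presented_mulE.
by rewrite !presented_homE /word_value big_cat.
Qed.

HB.instance Definition _ P N f (fP : @respects_rules P N f) :=
  isUMagmaMorphism.Build (presented P) N (presented_hom fP)
    (presented_hom_is_morphism fP).

Definition monoid_isomorphism (M N : monoidType) (f : M -> N) :=
  monoid.monoid_morphism f /\ bijective f.

Definition is_presentation_of (P : presentation) (N : monoidType) :=
  exists f : presented P -> N, monoid_isomorphism f.

Inductive generated (M : monoidType) (S : set M) : M -> Prop :=
| generated_in f : S f -> generated S f
| generated_one : generated S 1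
| generated_mul f g : generated S f -> generated S g -> generated S (f * g).

Section GeneratedMonoid.
Variables (M : monoidType) (S : set M).

Definition generatedb : pred M := fun f => `[< generated S f >].

Fact generatedb_closed : monoid_closed generatedb.
Proof.
split; first by apply/asboolP; exact: generated_one.
by move=> f g /asboolP Sf /asboolP Sg; apply/asboolP; exact: generated_mul.
Qed.

Definition genmonoid := {f : M | generatedb f}.
HB.instance Definition _ := SubChoice.on genmonoid.
HB.instance Definition _ :=
  SubChoice_isSubMonoid.Build M generatedb genmonoid generatedb_closed.

Definition genmonoid_gen f (Sf : S f) : genmonoid :=
  exist generatedb f (asboolT (generated_in Sf)).

End GeneratedMonoid.

(* Multiplication is composition: (f * g) x = f (g x). *)
Definition selfmap (T : Type) := T -> T.

Section Selfmap.
Variable T : Type.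

HB.instance Definition _ := gen_eqMixin (selfmap T).
HB.instance Definition _ := gen_choiceMixin (selfmap T).

Definition selfmap_mul (f g : selfmap T) : selfmap T := f \o g.

Fact selfmap_mulA : associative selfmap_mul.
Proof. by []. Qed.

Fact selfmap_mul1 : left_id (idfun : selfmap T) selfmap_mul.
Proof. by []. Qed.

Fact selfmap_1mul : right_id (idfun : selfmap T) selfmap_mul.
Proof. by []. Qed.

HB.instance Definition _ := isMonoid.Build (selfmap T)
  selfmap_mulA selfmap_mul1 selfmap_1mul.

End Selfmap.

Variant idx23 := two | three.

Definition nat_of_idx23 (i : idx23) : nat :=
  match i with two => 2 | three => 3 end.
Coercion nat_of_idx23 : idx23 >-> nat.

(* The letters A, B, C_i, c_i; one alphabet serves for both values of i. *)
Variant letter := LA | LB | LC | Lc.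

Definition letter_code (a : letter) : bool * bool :=
  match a with
  | LA => (false, false) | LB => (false, true)
  | LC => (true, false) | Lc => (true, true)
  end.
Definition letter_decode (p : bool * bool) : letter :=
  match p with
  | (false, false) => LA | (false, true) => LB
  | (true, false) => LC | (true, true) => Lc
  end.
Fact letter_codeK : cancel letter_code letter_decode.
Proof. by case. Qed.
HB.instance Definition _ := Choice.copy letter (can_type letter_codeK).

Section Rules.
Let A := LA.
Let B := LB.
Let C := LC.
Let c := Lc.

Definition rules2 : seq (seq letter * seq letter) :=
  [:: ([:: C; A; A], [:: A; C]);
      ([:: C; B],    [:: B; B; C]);
      ([:: C; A; B], [:: B; A; c]);
      ([:: c; A],    [:: A; A; c]);
      ([:: c; B; B], [:: B; c]);
      ([:: c; B; A], [:: A; B; C]);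
      ([:: C; c],    [::]);
      ([:: c; C],    [::])].

Definition rules3 : seq (seq letter * seq letter) :=
  [:: ([:: C; A; A; A], [:: A; C]);
      ([:: C; A; A; B], [:: B; A; A; c]);
      ([:: C; A; B; A], [:: B; A; B; C]);
      ([:: C; A; B; B], [:: B; B; A; c]);
      ([:: C; B],       [:: B; B; B; C]);
      ([:: c; A],       [:: A; A; A; c]);
      ([:: c; B; A; A], [:: A; A; B; C]);
      ([:: c; B; A; B], [:: A; B; A; c]);
      ([:: c; B; B; A], [:: A; B; B; C]);
      ([:: c; B; B; B], [:: B; c]);
      ([:: C; c],       [::]);
      ([:: c; C],       [::])].

End Rules.

Definition Pres (i : idx23) : presentation :=
  @Presentation letter
    (fun r => r \in match i with two => rules2 | three => rules3 end).

Local Open Scope ring_scope.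

Definition I01 (R : realType) := {x : R | 0 <= x < 1}.

Section Maps.
Variables (R : realType) (i : idx23).
Implicit Type x : I01 R.

Let iE : (i%:R = 2 :> R) \/ (i%:R = 3 :> R).
Proof. by case: i; [left | right]. Qed.

Fact TA_subproof x : 0 <= val x / (val x + 1) < 1.
Proof.
have /andP[x0 x1] := valP x.
by rewrite divr_ge0 ?ltr_pdivrMr; lra.
Qed.

Fact TB_subproof x : 0 <= 1 / (2 - val x) < 1.
Proof.
have /andP[x0 x1] := valP x.
by rewrite divr_ge0 ?ltr_pdivrMr; lra.
Qed.

Fact TC_subproof x : 0 <= i%:R * val x / ((i%:R - 1) * val x + 1) < 1.
Proof.
have /andP[x0 x1] := valP x.
by case: iE => ->; rewrite divr_ge0 ?ltr_pdivrMr; lra.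
Qed.

Fact Tc_subproof x : 0 <= val x / (i%:R - (i%:R - 1) * val x) < 1.
Proof.
have /andP[x0 x1] := valP x.
by case: iE => ->; rewrite divr_ge0 ?ltr_pdivrMr; lra.
Qed.

(* T_A and T_B are seen as self-maps of [0, 1), their images being contained
   in [0, 1/2) and [1/2, 1); Tc is the inverse of TC, see TCK and TcK. *)
Definition TA : selfmap (I01 R) := fun x =>
  Sub (val x / (val x + 1)) (TA_subproof x).
Definition TB : selfmap (I01 R) := fun x =>
  Sub (1 / (2 - val x)) (TB_subproof x).
Definition TC : selfmap (I01 R) := fun x =>
  Sub (i%:R * val x / ((i%:R - 1) * val x + 1)) (TC_subproof x).
Definition Tc : selfmap (I01 R) := fun x =>
  Sub (val x / (i%:R - (i%:R - 1) * val x)) (Tc_subproof x).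

Lemma TA_lt x : val (TA x) < 1 / 2.
Proof.
have /andP[x0 x1] := valP x.
by rewrite SubK ltr_pdivrMr; lra.
Qed.

Lemma TB_ge x : 1 / 2 <= val (TB x).
Proof.
have /andP[x0 x1] := valP x.
by rewrite SubK ler_pdivlMr; lra.
Qed.

Lemma TCK : cancel TC Tc.
Proof.
move=> x; apply: val_inj; rewrite !SubK; have /andP[x0 x1] := valP x.
by case: iE => ->; field; rewrite ?andbT;
  repeat (apply/andP; split); apply/eqP => h; lra.
Qed.

Lemma TcK : cancel Tc TC.
Proof.
move=> x; apply: val_inj; rewrite !SubK; have /andP[x0 x1] := valP x.
by case: iE => ->; field; rewrite ?andbT;
  repeat (apply/andP; split); apply/eqP => h; lra.
Qed.

Definition Mgens : set (selfmap (I01 R)) := [set TA; TB; TC; Tc].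

Definition Mon : monoidType := genmonoid Mgens.

Definition T (a : letter) : selfmap (I01 R) :=
  match a with LA => TA | LB => TB | LC => TC | Lc => Tc end.

Fact T_gen a : Mgens (T a).
Proof. by rewrite /Mgens; case: a => /=; tauto. Qed.

Definition letter_map (a : symbols (Pres i)) : Mon := genmonoid_gen (T_gen a).

Lemma val_word_value (w : seq (symbols (Pres i))) :
  val (word_value letter_map w) = foldr (fun a f => T a \o f) idfun w.
Proof.
rewrite /word_value; elim: w => [|a w IH]; first by rewrite big_nil.
by rewrite big_cons /= -IH.
Qed.

End Maps.

Fact letter_map_respects_rules (R : realType) (i : idx23) :
  respects_rules (@letter_map R i).
Proof.
case: i => r1 r2; rewrite /rules/= !inE !xpair_eqE => r;
  apply: val_inj; rewrite !val_word_value;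
  apply/funext => -[x hx]; apply: val_inj; have /andP[x0 x1] := hx; move: r;
  repeat (case/orP); move=> /andP[/eqP -> /eqP ->];
  rewrite /= ?SubK /=; field; rewrite ?andbT;
  repeat (apply/andP; split); apply/eqP => h; lra.
Qed.

Definition piM (R : realType) (i : idx23) : presented (Pres i) -> Mon R i :=
  presented_hom (@letter_map_respects_rules R i).

Lemma piM_word (R : realType) (i : idx23) (w : seq letter) :
  val (piM R (pclass (w : seq (symbols (Pres i))))) =
    foldr (fun a f => @T R i a \o f) idfun w.
Proof. by rewrite /piM presented_homE val_word_value. Qed.

(* Main.v *)
(** In the coordinate t = x / (1 - x) the generators become the matrices
    A = [[1,0],[1,1]], B = [[1,1],[0,1]], C = diag(i,1), c = diag(1,i) up to
    scalars. Reading the relations from left to right pushes C and c to the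
    right and terminates, so every word is congruent to an irreducible one, and
    it suffices that distinct irreducible words define distinct maps.

    The integer matrix of an irreducible word is nonzero mod i (its letters C
    and c describe a path without backtracking in the tree of PGL_2(Q_i)), and
    its determinant is a power of the prime i, so the map determines the matrix.
    If two irreducible words have the same matrix, remove their common prefix.
    First letters A and B are incompatible by comparing rows, and C and c by
    reducing mod i. If C u = U x v with U a nonempty word in A, B and x = C or c,
    then reduction mod i shows that K = C^-1 U x has natural entries and
    determinant 1, hence is a word in A, B; by induction on the number of letters
    C and c, u = K v as words. As C K v is irreducible, K is too short for C K to
    be of the form U x. *)
Require Import Defs.
From mathcomp Require Import all_boot all_order all_algebra.
From mathcomp Require Import reals.
From mathcomp Require Import boolp.
From mathcomp Require Import zify ring lra.

Set Implicit Arguments.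
Unset Strict Implicit.
Unset Printing Implicit Defensive.
Import Order.TTheory GRing.Theory Num.Theory.

(** * Termination of the rewriting and reduction to irreducible words *)

Definition rule_list (i : idx23) := match i with two => rules2 | three => rules3 end.

Fixpoint irr (i : idx23) (w : seq letter) : bool :=
  if w is _ :: w' then
    ~~ has (fun r => prefix r.1 w) (rule_list i) && irr i w'
  else true.

(** Termination measure. The factor 4 exceeds 3, the largest number of letters A, B that a rule
    places in front of C or c. *)
Fixpoint weight (w : seq letter) : nat :=
  match w with
  | [::] => 1
  | (LA | LB) :: w' => (weight w').+1
  | (LC | Lc) :: w' => 4 * weight w'
  end.

Lemma weight_gt0 w : 0 < weight w.
Proof. by elim: w => [|[] w IH] //=; rewrite muln_gt0. Qed.

Lemma weight_catl a u v : weight u < weight v -> weight (a ++ u) < weight (a ++ v).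
Proof. by move=> uv; elim: a => [|[] a IH] //=; lia. Qed.

Lemma weight_rule i r b :
  r \in rule_list i -> weight (r.2 ++ b) < weight (r.1 ++ b).
Proof.
by have := weight_gt0 b; case: i; rewrite !inE => b0;
  repeat (case/orP); move=> /eqP -> /=; lia.
Qed.

Lemma reducible_rule i w : ~~ irr i w ->
  exists a b r, r \in rule_list i /\ w = a ++ r.1 ++ b.
Proof.
elim: w => [|x w IH] // /nandP[/negPn /hasP[r ri /prefixP[b ->]]|].
  by exists [::], b, r.
by move=> /IH[a [b [r [ri ->]]]]; exists (x :: a), b, r.
Qed.

Lemma cong_irr i (w : seq letter) : exists2 v, irr i v & @cong (Pres i) w v.
Proof.
elim: {w}(weight w) {-2}w (leqnn (weight w)) => [|n IH] w wn.
  by have := weight_gt0 w; lia.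
have [wi|/reducible_rule[a [b [r [ri wE]]]]] := boolP (irr i w).
  by exists w => //; exact: cong_refl.
have lt_w : weight (a ++ r.2 ++ b) < weight w.
  by rewrite wE weight_catl // (weight_rule _ ri).
have [|v vi wv] := IH (a ++ r.2 ++ b); first by lia.
exists v => //; apply: cong_trans wv; rewrite wE.
by apply: cong_rule; clear -ri; case: i ri; case: r.
Qed.

(** * Matrices of words over the natural numbers *)

(* The generators act on t = z.1 / z.2. *)
Definition act1 (i : nat) (x : letter) (z : nat * nat) : nat * nat :=
  match x with
  | LA => (z.1, z.1 + z.2)
  | LB => (z.1 + z.2, z.2)
  | LC => (i * z.1, z.2)
  | Lc => (z.1, i * z.2)
  end.

(** Pairs are not normalised: Cc multiplies both coordinates by [i], so equal maps a priori give
    only proportional pairs. *)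
Definition act (i : nat) (w : seq letter) (z : nat * nat) : nat * nat :=
  foldr (act1 i) z w.

Lemma act_cat i u v z : act i (u ++ v) z = act i u (act i v z).
Proof. exact: foldr_cat. Qed.

Definition is_C (x : letter) : bool := if x is (LC | Lc) then true else false.

Lemma act_mx (i : nat) w : exists p q r s : nat,
  (forall a b, act i w (a, b) = (p * a + q * b, r * a + s * b)) /\
  p * s = q * r + i ^ count is_C w.
Proof.
elim: w => [|x w [p [q [r [s [E D]]]]]].
  by exists 1, 0, 0, 1; split=> // a b; congr (_, _); lia.
case: x => /=.
- exists p, q, (p + r), (q + s); split; last by rewrite add0n; nia.
  by move=> a b; rewrite E /=; congr (_, _); nia.
- exists (p + r), (q + s), r, s; split; last by rewrite add0n; nia.
  by move=> a b; rewrite E /=; congr (_, _); nia.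
- exists (i * p), (i * q), r, s; split; last by rewrite expnS; nia.
  by move=> a b; rewrite E /=; congr (_, _); nia.
- exists p, q, (i * r), (i * s); split; last by rewrite expnS; nia.
  by move=> a b; rewrite E /=; congr (_, _); nia.
Qed.

Lemma idx_prime (i : idx23) : prime i.
Proof. by case: i. Qed.

(** Euclid's algorithm on rows: unless the matrix is the identity, one row dominates the other, and
    subtracting strips off a first letter B or A. *)
Lemma sl2_word (i a b c d : nat) : a * d = b * c + 1 -> exists K,
  all (predC is_C) K /\
  forall x y, act i K (x, y) = (a * x + b * y, c * x + d * y).
Proof.
elim: {a b c d}(a + b + c + d) {-2}a {-2}b {-2}c {-2}d
  (leqnn (a + b + c + d)) => [|n IH] a b c d le_n D.
  by have a0 : a = 0 by [lia]; move: D; rewrite a0; lia.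
have [[ca db]|[[ac bd]|[a1 b0 c0 d1]]] :
    (c <= a /\ d <= b) \/ (a <= c /\ b <= d) \/ [/\ a = 1, b = 0, c = 0 & d = 1].
  have [ca|ac] := leqP c a; have [db|bd] := leqP d b; try by [left|].
  - have [->|] := eqVneq a c; first by right; left; lia.
    move=> ac; right; right.
    (* No row dominates: [a > c] and [d > b]. Against [a * d = b * c + 1] this bound leaves only
       [b = c = 0]. *)
    have : (c + 1) * (b + 1) <= a * d by apply: leq_mul; lia.
    move=> lt_ad; have [b0 c0] : b = 0 /\ c = 0 by nia.
    move: D; rewrite b0 c0 => /eqP.
    by rewrite muln_eq1 => /andP[/eqP -> /eqP ->].
  - right; left; nia.
  - by right; left; lia.
- have [|| K [Kab KE]] := IH (a - c) (b - d) c d; [by nia|by nia|].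
  exists (LB :: K); split=> // x y; rewrite /= KE /=.
  by congr (_, _); nia.
- have [|| K [Kab KE]] := IH a b (c - a) (d - b); [by nia|by nia|].
  exists (LA :: K); split=> // x y; rewrite /= KE /=.
  by congr (_, _); nia.
- by exists [::]; split=> // x y; rewrite a1 b0 c0 d1; congr (_, _); lia.
Qed.

(** * Irreducible words modulo [i] *)

Lemma irr_cons i x w : irr i (x :: w) -> irr i w.
Proof. by case/andP. Qed.

(* Conjugation by t |-> 1 / t. *)
Definition flip (x : letter) : letter :=
  match x with LA => LB | LB => LA | LC => Lc | Lc => LC end.

Lemma flipK : involutive flip.
Proof. by case. Qed.

(** The swap of A with B and of C with c permutes the left sides of the rules. *)
Lemma irr_flip i w : irr i (map flip w) = irr i w.
Proof.
elim: w => [|x w IH] //; rewrite [map _ _]/= [irr i (_ :: _)]/= IH.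
rewrite [RHS]/=; congr (~~ _ && _) => {IH}.
by case: i; case: x; case: w => [|[] [|[] [|[] w]]] //=; rewrite !prefix0s.
Qed.

Lemma act_flip i w z : act i (map flip w) (z.2, z.1) = ((act i w z).2, (act i w z).1).
Proof. by elim: w => [|[] w IH] //=; rewrite -/(act _ _ _) IH //= addnC. Qed.

Lemma AB_prefix v : exists K w, [/\ v = K ++ w, all (predC is_C) K &
  w = [::] \/ exists x w', is_C x /\ w = x :: w'].
Proof.
elim: v => [|x v [K [w [-> Kab wE]]]]; first by exists [::], [::]; split=> //; left.
have [xC|xAB] := boolP (is_C x).
  by exists [::], (x :: K ++ w); split=> //; right; exists x, (K ++ w).
by exists (x :: K), w; split=> //=; rewrite xAB.
Qed.

(** Only K = 1, A (and AA, AB for [i = 3]) can follow C; [(c, d)] is the bottom row of the matrix of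
    K. *)
Lemma irr_C_AB (i : idx23) K w :
  all (predC is_C) K -> irr i (LC :: K ++ w) ->
  exists c d, [/\ forall z, (act i K z).2 = c * z.1 + d * z.2,
    ~~ (i %| d) & K = [::] \/ ~~ (i %| c)].
Proof.
case: i; case: K => [|[] [|[] [|[] K]]] //=; rewrite ?prefix0s //= => _ _.
- by exists 0, 1; split=> // [z|]; [lia|left].
- by exists 1, 1; split=> // [z|]; [lia|right].
- by exists 0, 1; split=> // [z|]; [lia|left].
- by exists 1, 1; split=> // [z|]; [lia|right].
- by exists 2, 1; split=> // [z|]; [lia|right].
- by exists 1, 2; split=> // [z|]; [lia|right].
Qed.

Lemma irr_catr i u w : irr i (u ++ w) -> irr i w.
Proof. by elim: u => // x u IH /irr_cons. Qed.

Lemma irr_catl i K w : all (predC is_C) K -> irr i w -> irr i (K ++ w).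
Proof.
elim: K => [|x K IH] //= /andP[xC KC] wi; rewrite IH // andbT.
by case: x xC => // _; case: (i).
Qed.

(** Modulo [i], a letter C or c after the A, B prefix K kills one coordinate, so the bottom row of K
    leaves a unit times the other one, to which induction applies. *)
Lemma irr_primitive_C (i : idx23) v :
  irr i (LC :: v) -> exists z, ~~ (i %| (act i v z).2).
Proof.
elim: {v}(size v) {-2}v (leqnn (size v)) => [|n IH] v.
  by case: v => // _; exists (0, 1); case: (i).
move=> vn vi; have [K [w [vE Kab wE]]] := AB_prefix v.
have wi : irr i w by move: vi => /irr_cons; rewrite vE => /irr_catr.
have [|c [d [KE dP Kc]]] := irr_C_AB (i := i) (w := w) Kab; first by rewrite -vE.
rewrite {}vE in vn vi *.
case: wE => [->|[x [w' [xC wE]]]].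
  by exists (0, 1); rewrite cats0 KE muln0 muln1.
have w'n : size w' <= n by move: vn; rewrite wE size_cat /=; lia.
case: x xC wE => // _ wE; rewrite {}wE in vn vi wi *.
- have [z zP] := IH w' w'n wi; exists z.
  rewrite act_cat KE /= dvdn_addr; last by rewrite mulnCA dvdn_mulr.
  by rewrite Euclid_dvdM ?idx_prime // negb_or dP.
(* For x = c the surviving coordinate is the first; flipping makes it the second. K is nonempty,
   since Cc is reducible. *)
- have [||z zP] := IH (map flip w'); first by rewrite size_map.
    by rewrite -irr_flip /= (mapK flipK).
  exists (z.2, z.1); rewrite act_cat KE /= dvdn_addl; last first.
    by rewrite mulnCA dvdn_mulr.
  rewrite -[w'](mapK flipK) act_flip /= Euclid_dvdM ?idx_prime // negb_or zP andbT.
  by case: Kc => // K0; move: vi; rewrite K0; case: (i) => /=; rewrite prefix0s.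
Qed.

Lemma irr_primitive_c (i : idx23) v :
  irr i (Lc :: v) -> exists z, ~~ (i %| (act i v z).1).
Proof.
rewrite -irr_flip => /irr_primitive_C[z zP].
by exists (z.2, z.1); rewrite -[v](mapK flipK) act_flip.
Qed.

(** A and B are invertible modulo [i], so the claim reduces to the first C or c. *)
Lemma irr_primitive (i : idx23) v :
  irr i v -> exists z, ~~ ((i %| (act i v z).1) && (i %| (act i v z).2)).
Proof.
elim: v => [|x v IH vi]; first by exists (1, 1); case: (i).
case: x vi => vi /=.
- have [z zP] := IH (irr_cons vi); exists z; apply: contra zP => /andP[z1].
  by rewrite dvdn_addr // => ->; rewrite z1.
- have [z zP] := IH (irr_cons vi); exists z; apply: contra zP => /andP[z1 z2].
  by rewrite -(dvdn_addl _ z2) z1.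
- by have [z /negPf zP] := irr_primitive_C vi; exists z; rewrite zP andbF.
- by have [z /negPf zP] := irr_primitive_c vi; exists z; rewrite zP.
Qed.

(** * Irreducible words are determined by their matrices *)

Lemma act1_inj (i : idx23) x : injective (act1 i x).
Proof. by case: i; case: x => -[a b] [c d] /= [] h1 h2; congr (_, _); lia. Qed.

Lemma act_eq_count (i : idx23) u v :
  act i u =1 act i v -> count is_C u = count is_C v.
Proof.
move=> uv; have [p [q [r [s [E D]]]]] := act_mx i u.
have [p' [q' [r' [s' [E' D']]]]] := act_mx i v.
have := uv (1, 0); have := uv (0, 1); rewrite !E !E' => -[? ?] [? ?].
have /eqP : i ^ count is_C u = i ^ count is_C v by nia.
by rewrite eqn_exp2l => [/eqP//|]; case: (i).
Qed.

Lemma irr_C_AB_neq (i : idx23) (u v : seq letter) (y : letter) :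
  (forall u' v', count is_C u' <= count is_C u -> irr i u' -> irr i v' ->
     act i u' =1 act i v' -> u' = v') ->
  irr i (LC :: u) -> irr i (y :: v) -> ~~ is_C y ->
  ~ act i (LC :: u) =1 act i (y :: v).
Proof.
move=> IH ui vi yAB uv; have [U [w [vE Uab wE]]] := AB_prefix v.
have cnt := act_eq_count uv.
have UyE : y :: v = (y :: U) ++ w by rewrite vE.
(* By equality of determinants, [v] too contains a letter C or c. *)
have {wE}[x [v' [xC wE]]] : exists x w', is_C x /\ w = x :: w'.
  case: wE => // w0; move: cnt; rewrite UyE w0 cats0 /= (negPf yAB) add0n.
  by move: Uab; rewrite all_predC has_count -leqNgt leqn0 => /eqP->.
have [a [b [c [d [UE D]]]]] := act_mx i (y :: U).
have {}D : a * d = b * c + 1.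
  move: D; rewrite /= (negPf yAB) add0n.
  by move: Uab; rewrite all_predC has_count -leqNgt leqn0 => /eqP->.
have Un1 : ~ [/\ a = 1, b = 0, c = 0 & d = 1].
  case=> a1 b0 c0 d1; have := UE 1 0; have := UE 0 1; rewrite a1 b0 c0 d1.
  by clear -yAB; case: y yAB => //= _ [? ?] [? ?]; lia.
have uvE z : act1 i LC (act i u z) =
   (a * (act1 i x (act i v' z)).1 + b * (act1 i x (act i v' z)).2,
    c * (act1 i x (act i v' z)).1 + d * (act1 i x (act i v' z)).2).
  by rewrite -UE -surjective_pairing (uv z : act1 i LC _ = _) UyE act_cat wE.
have v'i : irr i v' by move: vi; rewrite UyE wE => /irr_catr/irr_cons.
have xvi : irr i (x :: v') by move: vi; rewrite UyE wE => /irr_catr.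
have i0 : 0 < i by case: (i).
(* The [kj] are the entries of K = C^-1 U x, where U is [y :: U]. If x = C then K has rows (a, b/i),
   (ic, d); if x = c, rows (a/i, b), (c, id). Primitivity of [v'] gives the divisibility of b or
   a. *)
have [k1 [k2 [k3 [k4 [KD KE [m1 m2]]]]]] : exists k1 k2 k3 k4,
    [/\ k1 * k4 = k2 * k3 + 1,
      forall z, act i u z = (k1 * (act i v' z).1 + k2 * (act i v' z).2,
                             k3 * (act i v' z).1 + k4 * (act i v' z).2) &
      (i %| k4) || (i %| k3) /\ (k1 = 1 -> k2 = 0 -> k3 = 0 -> k4 = 1 -> False)].
  case: x xC wE uvE xvi => // _ wE uvE xvi.
  - have [z zP] := irr_primitive_C xvi.
    have /dvdnP[b' bE] : i %| b.
      have := uvE z; rewrite /= => -[] h _.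
      have : i %| b * (act i v' z).2.
        have dvd_l : i %| a * (i * (act i v' z).1) by rewrite mulnCA dvdn_mulr.
        by rewrite -(dvdn_addr _ dvd_l) -h dvdn_mulr.
      by rewrite Euclid_dvdM ?idx_prime // (negPf zP) orbF.
    exists a, b', (i * c), d; split; first by rewrite D bE; lia.
      move=> z'; have := uvE z'.
      case: (act i u z') (act i v' z') => [u1 u2] [v1 v2] /= [] h1 h2.
      by congr (_, _); nia.
    split; first by rewrite dvdn_mulr ?orbT.
    by move=> a1 b0 c0 d1; apply: Un1; split=> //; nia.
  - have [z zP] := irr_primitive_c xvi.
    have /dvdnP[a' aE] : i %| a.
      have := uvE z; rewrite /= => -[] h _.
      have : i %| a * (act i v' z).1.
        have dvd_r : i %| b * (i * (act i v' z).2) by rewrite mulnCA dvdn_mulr.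
        by rewrite -(dvdn_addl _ dvd_r) -h dvdn_mulr.
      by rewrite Euclid_dvdM ?idx_prime // (negPf zP) orbF.
    exists a', b, c, (i * d); split; first by nia.
      move=> z'; have := uvE z'.
      case: (act i u z') (act i v' z') => [u1 u2] [v1 v2] /= [] h1 h2.
      by congr (_, _); nia.
    split; first by rewrite dvdn_mulr.
    by move=> _ _ _; clear; case: i => /=; lia.
have [K [Kab KactE]] := sl2_word i KD.
have uK : u = K ++ v'.
  apply: IH => //; [exact: irr_cons ui|exact: irr_catl|].
  by move=> z; rewrite act_cat KE; case: (act i v' z) => ? ?; rewrite KactE.
have [|k3' [k4' [K2E k4P Kk3]]] := irr_C_AB (i := i) (w := v') Kab.
  by rewrite -uK.
have [k3E k4E] : k3' = k3 /\ k4' = k4.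
  by have := K2E (1, 0); have := K2E (0, 1); rewrite !KactE /=; lia.
(* The bottom row of K has an entry divisible by [i], which leaves only K = 1; but K is not the
   identity matrix. *)
case: Kk3 => [K0|k3P]; last by move: m1; rewrite -k3E -k4E (negPf k4P) (negPf k3P).
have := KactE 1 0; have := KactE 0 1; rewrite K0 /= => -[? ?] [? ?].
by apply: m2; lia.
Qed.

Lemma irr_c_AB_neq (i : idx23) (u v : seq letter) (y : letter) :
  (forall u' v', count is_C u' <= count is_C u -> irr i u' -> irr i v' ->
     act i u' =1 act i v' -> u' = v') ->
  irr i (Lc :: u) -> irr i (y :: v) -> ~~ is_C y ->
  ~ act i (Lc :: u) =1 act i (y :: v).
Proof.
have flip_C x : is_C (flip x) = is_C x by case: x.
have count_flip w : count is_C (map flip w) = count is_C w.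
  by rewrite count_map; apply: eq_count.
have act_flip_eq w w' : act i w =1 act i w' ->
    act i (map flip w) =1 act i (map flip w').
  by move=> ww [a b]; rewrite (act_flip i w (b, a)) (act_flip i w' (b, a)) ww.
move=> IH ui vi yAB uv.
apply: (@irr_C_AB_neq i (map flip u) (map flip v) (flip y)).
- move=> u' v'; rewrite count_flip -(irr_flip i u') -(irr_flip i v').
  rewrite -(count_flip u') => cu u'i v'i.
  by move=> /act_flip_eq /(IH _ _ cu u'i v'i); apply: inj_map; exact: inv_inj flipK.
- by rewrite -irr_flip /= (mapK flipK).
- by rewrite -irr_flip /= flipK (mapK flipK).
- by rewrite flip_C.
- exact: (act_flip_eq (Lc :: u) (y :: v)).
Qed.

Lemma act_nil_neq (i : idx23) x w : ~ act i [::] =1 act i (x :: w).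
Proof.
move=> h; have := act_eq_count h; case: x h => // h _; have := h (1, 0); have := h (0, 1).
all: by rewrite /=; case: (act i w _) (act i w _) => [a b] [c d] /= [? ?] [? ?]; lia.
Qed.

(** The bottom row dominates after A, the top row after B; equality makes the bottom row of [u]
    zero, against its determinant. *)
Lemma act_AB_neq (i : idx23) u v : ~ act i (LA :: u) =1 act i (LB :: v).
Proof.
move=> h; have [p [q [r [s [E D]]]]] := act_mx i u.
have [p' [q' [r' [s' [E' D']]]]] := act_mx i v.
have d0 : 0 < i ^ count is_C u by rewrite expn_gt0; case: (i).
have := h (1, 0); have := h (0, 1).
rewrite /= -/(act i u _) -/(act i v _) !E !E' /= => -[? ?] [? ?].
have [r0 s0] : r = 0 /\ s = 0 by lia.
by move: D; rewrite r0 s0; lia.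
Qed.

Lemma act_Cc_neq (i : idx23) u v :
  irr i (LC :: u) -> ~ act i (LC :: u) =1 act i (Lc :: v).
Proof.
move=> /irr_primitive_C[z zP] /(_ z) /= [_ h]; move: zP.
by rewrite /act h dvdn_mulr.
Qed.

Lemma irr_act_inj (i : idx23) u v :
  irr i u -> irr i v -> act i u =1 act i v -> u = v.
Proof.
(* Outer induction on the number of letters C, c; the inner one on [u] removes a common first
   letter. *)
elim: {u}(count is_C u).+1 {-2}u v (ltnSn (count is_C u)) => [|n IHn] //.
elim=> [|x u IHu] [|y v] // cu ui vi uv; try by case: (act_nil_neq uv).
  by case: (@act_nil_neq i x u) => z; rewrite uv.
have vu : act i (y :: v) =1 act i (x :: u) by move=> z; rewrite uv.
have cv : count is_C (y :: v) < n.+1 by rewrite (act_eq_count vu).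
have [xy|/eqP xy] := eqVneq x y.
  rewrite -{y}xy in uv vi {vu cv} *; congr (_ :: _); apply: IHu.
  - by move: cu => /=; lia.
  - exact: irr_cons ui.
  - exact: irr_cons vi.
  - by move=> z; apply: (@act1_inj i x); exact: uv.
have IHu' w : count is_C w < n -> forall u' v', count is_C u' <= count is_C w ->
    irr i u' -> irr i v' -> act i u' =1 act i v' -> u' = v'.
  by move=> wn u' v' u'w; apply: IHn; lia.
case: x y xy ui vi cu cv uv vu => -[] // _ ui vi cu cv uv vu; exfalso.
- exact: act_AB_neq uv.
- exact: (irr_C_AB_neq (IHu' v cv) vi ui _ vu).
- exact: (irr_c_AB_neq (IHu' v cv) vi ui _ vu).
- exact: act_AB_neq vu.
- exact: (irr_C_AB_neq (IHu' v cv) vi ui _ vu).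
- exact: (irr_c_AB_neq (IHu' v cv) vi ui _ vu).
- exact: (irr_C_AB_neq (IHu' u cu) ui vi _ uv).
- exact: (irr_C_AB_neq (IHu' u cu) ui vi _ uv).
- exact: act_Cc_neq ui uv.
- exact: (irr_c_AB_neq (IHu' u cu) ui vi _ uv).
- exact: (irr_c_AB_neq (IHu' u cu) ui vi _ uv).
- exact: act_Cc_neq vi vu.
Qed.

(** * From equal maps to equal matrices *)

(** For proportional M and M', adj(M) M' is a scalar k, so d M' = k M and k^2 = d d'. *)
Lemma proportional_mx (p q r s p' q' r' s' d d' : nat) :
  p * r' = p' * r -> p * s' + q * r' = p' * s + q' * r -> q * s' = q' * s ->
  p * s = q * r + d -> p' * s' = q' * r' + d' -> 0 < d ->
  exists k, [/\ k * k = d * d', d * p' = k * p, d * q' = k * q,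
                d * r' = k * r & d * s' = k * s].
Proof.
move=> e1 e2 e3 D D' d0.
(* Ensures that the truncated subtraction defining k is the true difference. *)
have le_k : q * r' <= s * p'.
  have p0 : 0 < p by nia.
  rewrite -(leq_pmul2l p0); nia.
exists (s * p' - q * r').
have := subnK le_k; set k := _ - _ => kE.
by split; nia.
Qed.

Lemma word_frac (R : realType) (i : idx23) w (x : I01 R) (a b : nat) :
  0 < b -> val x = (a%:R / (a%:R + b%:R))%R ->
  0 < (act i w (a, b)).2 /\
  val (foldr (fun l f => @T R i l \o f) idfun w x) =
    ((act i w (a, b)).1%:R / ((act i w (a, b)).1%:R + (act i w (a, b)).2%:R))%R.
Proof.
move=> b0 xE; elim: w => [|l w] //=; rewrite -/(act i w _).
set y := foldr _ _ _ _; case: (act i w (a, b)) => [z1 z2] /= [z20 yE].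
have r1 : (0 <= z1%:R :> R)%R by [].
have r2 : (0 < z2%:R :> R)%R by rewrite ltr0n.
split; first by case: l; rewrite /= ?muln_gt0 ?addn_gt0 z20 ?orbT //; case: (i).
by case: l; rewrite /= ?SubK yE ?natrD ?natrM; case: (i) => /=; field;
  repeat (apply/andP; split); apply/eqP => h; lra.
Qed.

Lemma word_cross (R : realType) (i : idx23) u v (a b : nat) :
  0 < b ->
  foldr (fun l f => @T R i l \o f) idfun u =
    foldr (fun l f => @T R i l \o f) idfun v ->
  (act i u (a, b)).1 * (act i v (a, b)).2 = (act i v (a, b)).1 * (act i u (a, b)).2.
Proof.
move=> b0 uv.
have xP : (0 <= (a%:R : R) / (a%:R + b%:R) < 1)%R.
  have r2 : (0 < b%:R :> R)%R by rewrite ltr0n.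
  have r1 : (0 <= a%:R :> R)%R by [].
  by rewrite divr_ge0 ?ltr_pdivrMr; lra.
pose x : I01 R := Sub (a%:R / (a%:R + b%:R))%R xP.
have [u0 uE] := @word_frac R i u x a b b0 erefl.
have [v0 vE] := @word_frac R i v x a b b0 erefl.
move: uE; rewrite uv vE => /eqP.
case: (act i u _) (act i v _) u0 v0 => [u1 u2] [v1 v2] /= u0 v0 {uv vE}.
have r1 : (0 <= u1%:R :> R)%R by [].
have r1' : (0 <= v1%:R :> R)%R by [].
have r2 : (0 < u2%:R :> R)%R by rewrite ltr0n.
have r2' : (0 < v2%:R :> R)%R by rewrite ltr0n.
rewrite eqr_div; [|by apply/eqP => h; lra..].
rewrite -!natrD -!natrM eqr_nat => /eqP; nia.
Qed.

Lemma fun_eq_act (R : realType) (i : idx23) u v : irr i u -> irr i v ->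
  foldr (fun l f => @T R i l \o f) idfun u =
    foldr (fun l f => @T R i l \o f) idfun v ->
  act i u =1 act i v.
Proof.
move=> ui vi uv; have cross a b b0 := @word_cross R i u v a b b0 uv.
have [p [q [r [s [E D]]]]] := act_mx i u.
have [p' [q' [r' [s' [E' D']]]]] := act_mx i v.
(* Cross-multiplying gives quadratic forms in [(a, b)]; three points with [b > 0] determine their
   coefficients. *)
have := cross 0 1 isT; have := cross 1 1 isT; have := cross 1 2 isT.
rewrite !E !E' /= => h12 h11 h01.
have e3 : q * s' = q' * s by lia.
have [e1 e2] : p * r' = p' * r /\ p * s' + q * r' = p' * s + q' * r by nia.
have i1 : 1 < i by case: (i).
have [|k [kk kp kq kr ks]] := proportional_mx e1 e2 e3 D D'.
  by rewrite expn_gt0 ltnW.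
move: kk kp kq kr ks; set n := count is_C u; set n' := count is_C v => kk kp kq kr ks.
have kE z : i ^ n * (act i v z).1 = k * (act i u z).1 /\
            i ^ n * (act i v z).2 = k * (act i u z).2.
  by case: z => a b; rewrite E E' /=; split; rewrite !mulnDr !mulnA ?kp ?kq ?kr ?ks.
have [l _ kl] : exists2 l, l <= n + n' & k = i ^ l.
  by apply/dvdn_pfactor; rewrite ?idx_prime // expnD -kk dvdn_mulr.
have pow_lt m m' (a b : nat) : i ^ m * a = i ^ m' * b -> m < m' -> i %| a.
  move=> h mm'; have := subnKC mm'; move: (m' - m.+1) => e eE.
  move: h; rewrite -eE addSnnS expnD expnS -mulnA => /eqP.
  rewrite eqn_pmul2l ?expn_gt0 ?(ltnW i1) // => /eqP ->.
  by rewrite -mulnA dvdn_mulr.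
(* Otherwise [i] divides all values of [act i v] or of [act i u], against primitivity. *)
have nl : n = l.
  have [lt_nl|lt_ln|//] := ltngtP n l.
    have [z /negP[]] := irr_primitive vi; have [h1 h2] := kE z.
    by rewrite kl in h1 h2; rewrite (pow_lt _ _ _ _ h1 lt_nl) (pow_lt _ _ _ _ h2 lt_nl).
  have [z /negP[]] := irr_primitive ui; have [h1 h2] := kE z.
  by rewrite kl in h1 h2; rewrite (pow_lt _ _ _ _ (esym h1) lt_ln) (pow_lt _ _ _ _ (esym h2) lt_ln).
move=> z; have [] := kE z; rewrite kl nl.
move=> /eqP; rewrite eqn_pmul2l ?expn_gt0 ?(ltnW i1) // => /eqP h1.
move=> /eqP; rewrite eqn_pmul2l ?expn_gt0 ?(ltnW i1) // => /eqP h2.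
by rewrite [LHS]surjective_pairing -h1 -h2 -surjective_pairing.
Qed.

(** * Bijectivity of [piM] *)

Lemma piM_inj (R : realType) (i : idx23) : injective (@piM R i).
Proof.
elim/presentedW=> u; elim/presentedW=> v uv; apply/pclassP.
have [u' u'i uu'] := cong_irr i u; have [v' v'i vv'] := cong_irr i v.
have u'v' : u' = v'.
  apply: (irr_act_inj u'i v'i); apply: (fun_eq_act (R := R)) => //.
  rewrite -2!piM_word; congr val.
  by rewrite -(proj2 (pclassP _ _) uu') -(proj2 (pclassP _ _) vv').
by apply: cong_trans uu' _; rewrite u'v'; exact: cong_sym.
Qed.

Lemma piM_surj (R : realType) (i : idx23) (f : Mon R i) : exists x, piM R x = f.
Proof.
case: f => f fP; have := asboolW fP => gf.
suff [w wE] : exists w : seq letter, foldr (fun l g => @T R i l \o g) idfun w = f.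
  exists (pclass (w : seq (symbols (Pres i)))).
  by apply: val_inj; rewrite piM_word.
elim: gf => {f fP} [f|| f g _ [u <-] _ [v <-]].
- by move=> [[[->|->]|->]|->]; [exists [:: LA]|exists [:: LB]|exists [:: LC]|exists [:: Lc]].
- by exists [::].
- exists (u ++ v); elim: u => [|x u IH] //=; by rewrite IH.
Qed.

Theorem theorem7p26 (R : realType) (i : idx23) :
  monoid_isomorphism (@piM R i) /\ is_presentation_of (Pres i) (Mon R i).
Proof.
have iso : monoid_isomorphism (@piM R i).
  split; first exact: presented_hom_is_morphism.
  pose g f := projT1 (cid (@piM_surj R i f)).
  have gK : cancel g (@piM R i) by move=> f; exact: projT2 (cid (piM_surj f)).
  by exists g => // x; apply: (@piM_inj R i); rewrite gK.
by split=> //; exists (@piM R i).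
Qed.
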